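(* Consider the one-dimensional linear transport equation $u_t+(a(x,t)u)_x=0$ on $[x_a,x_b]$ with periodic boundary conditions, and the fully discrete Eulerian-Lagrangian discontinuous Galerkin (ELDG) scheme with strong-stability-preserving (SSP) Runge-Kutta time discretization described in the context. Given a DG solution $u_h(\cdot,t^n)\in V_h^k$, let $u_h(\cdot,t^{n+1})\in V_h^k$ be the solution produced by one step of the scheme. Then the scheme is locally mass conservative (in the sense defined in the context). In particular, $$\sum_{j=1}^N\int_{I_j}u_h(x,t^{n+1})\,dx=\sum_{j=1}^N\int_{I_j}u_h(x,t^n)\,dx .$$
   Context: **Mesh and space.** Let $x_a=x_{1/2}<x_{3/2}<\dots<x_{N+1/2}=x_b$, $I_j=[x_{j-1/2},x_{j+1/2}]$, $\Delta x_j=x_{j+1/2}-x_{j-1/2}$. Let $P^k(I_j)$ be the polynomials of degree at most $k$ on $I_j$, and $V_h^k=\{v_h: v_h|_{I_j}\in P^k(I_j)\ \forall j\}$. For each $j$ let $\{\Psi_{j,m}\}_{0\le m\le k}$ be a basis of $P^k(I_j)$. The velocity $a(x,t)$ is continuous; $a$, the mesh, and all discrete functions are extended periodically in $x$ with period $x_b-x_a$ (cell indices are taken modulo $N$). Let $\Delta t=t^{n+1}-t^n>0$. **Modified velocity and dynamic cells.** Put $\nu_{j+1/2}=a(x_{j+1/2},t^{n+1})$. On $I_j$ let $\alpha(\xi,t^{n+1})$ be the linear polynomial in $\xi$ with values $\nu_{j\pm1/2}$ at $\xi=x_{j\pm1/2}$. For $\xi\in I_j$ and $t\in[t^n,t^{n+1}]$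 let $$\tilde x(t;\xi)=\xi-\alpha(\xi,t^{n+1})(t^{n+1}-t),\qquad J_j(t)=\frac{\partial\tilde x(t;\xi)}{\partial\xi}=1-\frac{\nu_{j+1/2}-\nu_{j-1/2}}{\Delta x_j}(t^{n+1}-t).$$ Let $\tilde x_{j\pm1/2}(t)=x_{j\pm1/2}-\nu_{j\pm1/2}(t^{n+1}-t)$, $\tilde I_j(t)=[\tilde x_{j-1/2}(t),\tilde x_{j+1/2}(t)]$, and let $I_j^\star=\tilde I_j(t^n)$ be the upstream cell. The time step is such that characteristics do not cross, i.e. $J_j(t)>0$ for all $j$ and $t\in[t^n,t^{n+1}]$. The modified velocity is constant along these lines: $\alpha(\tilde x(t;\xi),t)=\alpha(\xi,t^{n+1})$. The test functions are $\psi_{j,m}(\tilde x(t;\xi),t)=\Psi_{j,m}(\xi)$, $\xi\in I_j$; in particular $\psi_{j,m}(\cdot,t)$ is a polynomial of degree at most $k$ on $\tilde I_j(t)$. **Spatial operator.** At time $t\in[t^n,t^{n+1}]$ the discrete solution on $\tilde I_j(t)$ is represented by a polynomial $u_h(\xi,t)\in P^k(I_j)$ in the reference variable $\xi\in I_j$ (the value at $\tilde x(t;\xi)$ is $u_h(\xi,t)$), and the degrees of freedom are $$\tilde U_{j,m}(t)=\int_{\tilde I_j(t)}u_h\,\psi_{j,m}\,dx=\int_{I_j}u_h(\xi,t)\Psi_{j,m}(\xi)J_j(t)\,d\xi,$$ which determine $u_h(\cdot,t)$ on each cell. Let $F(u)=(a-\alpha)u$, where $a-\alpha$ is evaluated at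 $(\tilde x(t;\xi),t)$. At the interface $\tilde x_{j+1/2}(t)$ let $u^-$ and $u^+$ be the traces of $u_h$ from the cells $\tilde I_j(t)$ and $\tilde I_{j+1}(t)$, respectively, and let the numerical flux be the single-valued Lax-Friedrichs flux $$\hat F_{j+1/2}=\tfrac12\big(F(u^-)+F(u^+)\big)-\tfrac{\alpha_0}{2}(u^+-u^-),\qquad \alpha_0=\max_u|F'(u)|,$$ where at the interface $a-\alpha=a(\tilde x_{j+1/2}(t),t)-\nu_{j+1/2}$. The operator $\mathcal L(\tilde{\mathbf U},t)$ has components $$\mathcal L_{j,m}=-\hat F_{j+1/2}\Psi_{j,m}(x_{j+1/2}^-)+\hat F_{j-1/2}\Psi_{j,m}(x_{j-1/2}^+)+Q_j\big[F(u_h)\,\partial_\xi\Psi_{j,m}\big],$$ where $Q_j$ is the $(k+1)$-point Gauss quadrature on $I_j$ approximating $\int_{I_j}\cdot\,d\xi$. **One step of the fully discrete scheme.** 1. (Initial condition by the semi-Lagrangian DG projection.) $\tilde U^{(0)}_{j,m}=\tilde U^n_{j,m}=\int_{I_j^\star}u_h(x,t^n)\psi_{j,m}(x,t^n)\,dx$, where $u_h(\cdot,t^n)\in V_h^k$ is the given piecewise polynomial on the fixed mesh (periodically extended); the integral is evaluated exactly by splitting $I_j^\star$ along the mesh points. 2. (SSP Runge-Kutta.) For $i=1,\dots,s$, $$\tilde{\mathbf U}^{(i)}=\sum_{l=0}^{i-1}\Big[\alpha_{il}\tilde{\mathbf U}^{(l)}+\beta_{il}\Delta t\,\mathcal L\big(\tilde{\mathbf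 U}^{(l)},t^n+d_l\Delta t\big)\Big],$$ where $\alpha_{il},\beta_{il}\ge0$, $\sum_{l=0}^{i-1}\alpha_{il}=1$ for each $i$, $d_l\in[0,1]$, are the coefficients of an explicit SSP Runge-Kutta method. For example, second order: $\alpha_{10}=1,\beta_{10}=1$; $\alpha_{20}=\alpha_{21}=\frac12$, $\beta_{20}=0,\beta_{21}=\frac12$; $d_0=0,d_1=1$. Third order: $\alpha_{10}=1,\beta_{10}=1$; $\alpha_{20}=\frac34,\alpha_{21}=\frac14$, $\beta_{20}=0,\beta_{21}=\frac14$; $\alpha_{30}=\frac13,\alpha_{31}=0,\alpha_{32}=\frac23$, $\beta_{30}=\beta_{31}=0,\beta_{32}=\frac23$; $d_0=0,d_1=1,d_2=\frac12$. At stage $l$, $u_h$ is recovered from $\tilde{\mathbf U}^{(l)}$ using $J_j(t^n+d_l\Delta t)$. 3. $u_h(\cdot,t^{n+1})\in V_h^k$ is defined by $\int_{I_j}u_h(x,t^{n+1})\Psi_{j,m}(x)\,dx=\tilde U^{(s)}_{j,m}$ for all $j,m$ (note $J_j(t^{n+1})=1$). **Local mass conservation.** The scheme is called locally mass conservative if there are constants $c_0,\dots,c_{s-1}$ depending only on the Runge-Kutta coefficients such that, for every $j$, $$\int_{I_j}u_h(x,t^{n+1})\,dx=\int_{I_j^\star}u_h(x,t^n)\,dx-\Delta t\sum_{l=0}^{s-1}c_l\big(\hat F^{(l)}_{j+1/2}-\hat F^{(l)}_{j-1/2}\big),$$ where $\hat F^{(l)}_{j+1/2}$ is the single-valued numerical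 flux at the interface $j+1/2$ at stage $l$. *)

(* Defs.v *)
From HB Require Import structures.
From mathcomp Require Import all_boot all_order all_algebra.
From mathcomp Require Import all_classical all_reals all_analysis.
From mathcomp Require Import ring.

Set Implicit Arguments.
Unset Strict Implicit.
Unset Printing Implicit Defensive.
Import Order.TTheory GRing.Theory Num.Theory.
Import numFieldNormedType.Exports.

Local Open Scope classical_set_scope.
Local Open Scope ring_scope.

(* Explicit SSP Runge-Kutta method with [rk_s] stages; only the entries
   [rk_alpha i l] and [rk_beta i l] with [l < i <= rk_s] and [rk_d l] with
   [l < rk_s] are meaningful. *)
Record ssp_rk (R : realType) := SspRk {
  rk_s : nat;
  rk_alpha : nat -> nat -> R;
  rk_beta : nat -> nat -> R;
  rk_d : nat -> R;
  rk_s_gt0 : (0 < rk_s)%N;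
  rk_alpha_ge0 : forall i l, (l < i <= rk_s)%N -> 0 <= rk_alpha i l;
  rk_beta_ge0 : forall i l, (l < i <= rk_s)%N -> 0 <= rk_beta i l;
  rk_alpha_sum : forall i, (0 < i <= rk_s)%N ->
    \sum_(l < i) rk_alpha i l = 1;
  rk_d_itv : forall l, (l < rk_s)%N -> 0 <= rk_d l <= 1 }.

(* N cells, polynomial degree k.  Cells are numbered from 0: cell j : 'I_N is
   [node j, node j.+1], so that [node i] is the mesh point x_{i+1/2} and only
   [node 0], ..., [node N] are used.  P^k is {poly_k.+1 R}, the polynomials of
   size at most k + 1. *)
Record eldg_data (R : realType) (N k : nat) := EldgData {
  node : nat -> R;
  vel : R -> R -> R;                             (* a(x, t) *)
  tn : R;
  dt : R;
  basis : 'I_N -> k.+1.-tuple {poly_k.+1 R};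
  gnode : 'I_N -> 'I_k.+1 -> R;
  gweight : 'I_N -> 'I_k.+1 -> R;
  N_gt0 : (0 < N)%N;
  node_lt : forall j : 'I_N, node j < node j.+1;
  dt_gt0 : 0 < dt;
  vel_continuous :
    {within [set z : R * R | tn <= z.2 <= tn + dt],
      continuous (fun z : R * R => vel z.1 z.2)};
  vel_periodic : forall x t, tn <= t <= tn + dt ->
    vel (x + (node N - node 0)) t = vel x t;
  basisP : forall j, basis_of fullv (basis j);
  (* A (k+1)-point rule is the Gauss rule iff it is exact up to degree 2k+1. *)
  gaussP : forall (j : 'I_N) (p : {poly R}), (size p <= 2 * k.+1)%N ->
    \sum_(i < k.+1) gweight j i * p.[gnode j i] =
      \int[lebesgue_measure]_(x in `[node j, node j.+1]) p.[x] }.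

Section Scheme.
Variables (R : realType) (N k : nat) (S : eldg_data R N k).

Local Notation node := (node S).
Local Notation vel := (vel S).
Local Notation tn := (tn S).
Local Notation dt := (dt S).

Definition tn1 : R := tn + dt.

(* The piecewise polynomials V_h^k, periodically extended.  Values at the mesh
   points are left free, so that functions may jump there. *)
Definition Vh (v : R -> R) : Prop :=
  (forall j : 'I_N, exists p : {poly_k.+1 R},
     forall x, node j < x < node j.+1 -> v x = (p : {poly R}).[x]) /\
  (forall x, v (x + (node N - node 0)) = v x).

Definition Psi (j : 'I_N) (m : 'I_k.+1) : {poly R} :=
  val (tnth (basis S j) m).

Definition nu (i : nat) : R := vel (node i) tn1.

(* alpha(xi, t^{n+1}) on I_j *)
Definition mod_vel (j : 'I_N) (xi : R) : R :=
  nu j + (nu j.+1 - nu j) / (node j.+1 - node j) * (xi - node j).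

Definition xtilde (j : 'I_N) (t xi : R) : R := xi - mod_vel j xi * (tn1 - t).

Definition jac (j : 'I_N) (t : R) : R :=
  1 - (nu j.+1 - nu j) / (node j.+1 - node j) * (tn1 - t).

Definition tnode (i : nat) (t : R) : R := node i - nu i * (tn1 - t).

Definition no_crossing : Prop :=
  forall (j : 'I_N) t, tn <= t <= tn1 -> 0 < jac j t.

Definition upstream_cell (j : 'I_N) : set R :=
  `[tnode j tn, tnode j.+1 tn]%classic.

(* psi_{j,m}(x, t): the argument of Psi is the preimage of x under the affine
   map xtilde j t, see psi_xtilde. *)
Definition psi (j : 'I_N) (m : 'I_k.+1) (x t : R) : R :=
  (Psi j m).[node j + (x - tnode j t) / jac j t].

Lemma psi_xtilde (j : 'I_N) (m : 'I_k.+1) (t xi : R) :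
  jac j t != 0 -> psi j m (xtilde j t xi) t = (Psi j m).[xi].
Proof.
move=> J0; rewrite /psi; congr (_.[_]).
have -> : xtilde j t xi - tnode j t = (xi - node j) * jac j t.
  by rewrite /xtilde /tnode /mod_vel /jac; ring.
by rewrite mulfK // addrC subrK.
Qed.

(* A discrete solution at time t, in the reference variable on each cell. *)
Definition dsol := 'I_N -> {poly_k.+1 R}.

Definition ev (u : dsol) (j : 'I_N) (xi : R) : R := (u j : {poly R}).[xi].

Definition dof (u : dsol) (t : R) (j : 'I_N) (m : 'I_k.+1) : R :=
  \int[lebesgue_measure]_(xi in `[node j, node j.+1])
    (ev u j xi * (Psi j m).[xi] * jac j t).

(* Lax-Friedrichs flux for F(u) = c * u. *)
Definition lf_flux (c um up : R) : R :=
  let F := fun u : R => c * u in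
  let alpha0 := sup [set `|derive1 F u| | u in [set: R]] in
  2^-1 * (F um + F up) - alpha0 / 2 * (up - um).

(* Flux at the right end of cell j.  The cells to the right and to the left
   of j, modulo N, are [ordS j] and [ord_pred j], so that the flux at the left
   end of cell j is [flux u t (ord_pred j)]. *)
Definition flux (u : dsol) (t : R) (j : 'I_N) : R :=
  lf_flux (vel (tnode j.+1 t) t - nu j.+1)
    (ev u j (node j.+1)) (ev u (ordS j) (node (ordS j))).

Definition gauss (j : 'I_N) (f : R -> R) : R :=
  \sum_(i < k.+1) gweight S j i * f (gnode S j i).

Definition rhs (u : dsol) (t : R) (j : 'I_N) (m : 'I_k.+1) : R :=
  - flux u t j * (Psi j m).[node j.+1]
  + flux u t (ord_pred j) * (Psi j m).[node j]
  + gauss j (fun xi => (vel (xtilde j t xi) t - mod_vel j xi) * ev u j xi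
                       * (Psi j m)^`().[xi]).

Definition stage_time (rk : ssp_rk R) (l : nat) : R := tn + rk_d rk l * dt.

(* One step from un = u_h(., t^n) to un1 = u_h(., t^{n+1}): U i is the vector
   of degrees of freedom of stage i, and w l is the discrete solution
   recovered from U l. *)
Record eldg_step (rk : ssp_rk R) (un : R -> R)
    (U : nat -> 'I_N -> 'I_k.+1 -> R) (w : nat -> dsol) (un1 : R -> R)
    : Prop := EldgStep {
  step_un : Vh un;
  step_un1 : Vh un1;
  step_init : forall j m, U 0%N j m =
    \int[lebesgue_measure]_(x in upstream_cell j) (un x * psi j m x tn);
  step_recover : forall l, (l < rk_s rk)%N ->
    forall j m, dof (w l) (stage_time rk l) j m = U l j m;
  step_stage : forall i, (0 < i <= rk_s rk)%N -> forall j m, U i j m =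
    \sum_(l < i) (rk_alpha rk i l * U l j m
                  + rk_beta rk i l * dt * rhs (w l) (stage_time rk l) j m);
  step_final : forall (j : 'I_N) m,
    \int[lebesgue_measure]_(x in `[node j, node j.+1])
      (un1 x * (Psi j m).[x]) = U (rk_s rk) j m }.

End Scheme.

Definition locally_mass_conservative (R : realType) (rk : ssp_rk R) : Prop :=
  exists c : nat -> R,
    forall (N k : nat) (S : eldg_data R N k) (un un1 : R -> R)
      (U : nat -> 'I_N -> 'I_k.+1 -> R) (w : nat -> dsol R N k),
    no_crossing S -> eldg_step S rk un U w un1 ->
    forall j : 'I_N,
      \int[lebesgue_measure]_(x in `[node S j, node S j.+1]) un1 x =
      \int[lebesgue_measure]_(x in upstream_cell S j) un x
      - dt S * \sum_(l < rk_s rk) c l *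
          (flux S (w l) (stage_time S rk l) j
           - flux S (w l) (stage_time S rk l) (ord_pred j)).

(* Main.v *)
(* Since 1 lies in P^k(I_j), a combination of the test functions Psi_{j,m} gives
   the cell mass.  For it the volume term of the spatial operator vanishes and
   only the difference of the two interface fluxes remains, so the Runge-Kutta
   recursion for the masses is linear in these differences with coefficients
   depending on the method alone.  For the total mass, the fluxes telescope and
   the upstream cells tile one full period, over which the periodic function
   u_h has the same integral as over [x_a, x_b]. *)
Require Import Defs.
From mathcomp Require Import all_boot all_order all_algebra.
From mathcomp Require Import all_classical all_reals all_analysis.
From mathcomp Require Import measurable_realfun.
From mathcomp Require Import ring lra.

Set Implicit Arguments.
Unset Strict Implicit.
Import Order.TTheory GRing.Theory Num.Theory.
Import numFieldNormedType.Exports.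

Local Open Scope classical_set_scope.
Local Open Scope ring_scope.

(** * Unrolling the Runge-Kutta recursion *)

(** Substituting earlier stages into later ones leaves [M 0] with weight 1, since each row of
    [alpha] sums to 1. The array [c] is quantified before [M], [F] and [h], so one choice serves
    every mesh, cell and solution. *)
Lemma rk_unroll (R : realType) (alpha beta : nat -> nat -> R) (s : nat) :
  (forall i, (0 < i <= s)%N -> \sum_(l < i) alpha i l = 1) ->
  exists c : nat -> nat -> R, forall (M F : nat -> R) (h : R),
    (forall i, (0 < i <= s)%N ->
       M i = \sum_(l < i) (alpha i l * M l + beta i l * h * F l)) ->
    forall i, (i <= s)%N -> M i = M 0%N + h * \sum_(l < s) c i l * F l.
Proof.
move=> alpha1.
pose unrolled n (c : nat -> nat -> R) := forall (M F : nat -> R) (h : R),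
    (forall i, (0 < i <= s)%N ->
       M i = \sum_(l < i) (alpha i l * M l + beta i l * h * F l)) ->
    forall i, (i <= n)%N -> M i = M 0%N + h * \sum_(l < s) c i l * F l.
suff H n : (n <= s)%N -> exists c, unrolled n c by exact: (H s).
elim: n => [_|n IH ns].
  exists (fun _ _ => 0) => M F h _ i; rewrite leqn0 => /eqP ->.
  by rewrite big1 ?mulr0 ?addr0 // => l _; rewrite mul0r.
have [c Hc] := IH (ltnW ns).
(* Row [n.+1] of the unrolled coefficients. The sum over [l] runs up to [s], so the test discards
   the meaningless entries [beta n.+1 l] with [l > n]. *)
pose new l := \sum_(i < n.+1) alpha n.+1 i * c i l
              + (if (l < n.+1)%N then beta n.+1 l else 0).
exists (fun i l => if i == n.+1 then new l else c i l) => M F h HM i.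
rewrite leq_eqVlt; have [-> _|/= _] := eqVneq i n.+1; last first.
  by rewrite ltnS; apply: Hc.
rewrite (HM n.+1) ?ns // big_split /=.
have -> : \sum_(i0 < n.+1) alpha n.+1 i0 * M i0 =
   M 0%N + h * \sum_(l < s) (\sum_(i < n.+1) alpha n.+1 i * c i l) * F l.
  transitivity (\sum_(i < n.+1) (alpha n.+1 i * M 0%N
      + h * \sum_(l < s) alpha n.+1 i * c i l * F l)).
    apply: eq_bigr => j _; rewrite (Hc M F h HM j) ?leq_ord // mulrDr.
    congr (_ + _); rewrite mulrCA; congr (_ * _); rewrite mulr_sumr.
    by apply: eq_bigr => l _; rewrite mulrA.
  rewrite big_split /= -mulr_suml alpha1 ?ns // mul1r -mulr_sumr.
  by rewrite exchange_big; under eq_bigr do rewrite -mulr_suml.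
have -> : \sum_(i0 < n.+1) beta n.+1 i0 * h * F i0 =
   h * \sum_(l < s) (if (l < n.+1)%N then beta n.+1 l else 0) * F l.
  rewrite (big_ord_widen s (fun l => beta n.+1 l * h * F l)) // big_mkcond.
  rewrite mulr_sumr; apply: eq_bigr => l _.
  by case: ifP => _; rewrite ?mul0r ?mulr0 // mulrCA mulrA.
rewrite -addrA -mulrDr -big_split /=; congr (_ + _ * _).
by apply: eq_bigr => l _; rewrite /new mulrDl.
Qed.

Lemma sum_RintegralZ (d : measure_display) (T : measurableType d) (R : realType)
    (mu : {measure set T -> \bar R}) (n : nat) (D : set T) (e : 'I_n -> R)
    (g : 'I_n -> T -> R) :
  measurable D -> (forall i, mu.-integrable D (EFin \o g i)) ->
  \sum_(i < n) e i * (\int[mu]_(x in D) g i x) =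
  \int[mu]_(x in D) (\sum_(i < n) e i * g i x).
Proof.
move=> mD ig.
have ieg i : mu.-integrable D (EFin \o (fun x => e i * g i x)).
  have := integrableZl mD (e i) (ig i).
  by apply: (eq_integrable mD) => x _ /=; rewrite EFinM.
under eq_bigr do rewrite -RintegralZl //.
rewrite [RHS]/Rintegral.
under [in RHS]eq_integral do rewrite -sumEFin.
rewrite integral_sum // -[LHS]/(fine (_)%:E) -sumEFin; congr fine.
apply: eq_bigr => i _; rewrite /Rintegral fineK //.
exact: (integrable_fin_num mD (ieg i)).
Qed.

Lemma periodicz (R : realType) (V : Type) (f : R -> V) (T : R) :
  (forall x, f (x + T) = f x) -> forall (m : int) x, f (x + m%:~R * T) = f x.
Proof.
move=> per; have pern n x : f (x + n%:R * T) = f x.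
  elim: n x => [|n IH] x; first by rewrite mul0r addr0.
  by rewrite -natr1 mulrDl mul1r addrA per IH.
case=> n x; first exact: pern.
by rewrite NegzE rmorphN mulNr -[LHS](pern n.+1) subrK.
Qed.

(** * Integrals over adjacent intervals and over periods *)

Section Integrals.
Variable R : realType.
Notation mu := (@lebesgue_measure R).
Implicit Types (f : R -> R) (a b : R).

(** Lebesgue measure is determined by its values on half-open intervals, and translation preserves
    their length. *)
Lemma lebesgue_measure_shift (c : R) (A : set R) : measurable A ->
  pushforward mu ((fun x => x + c) : _ -> measurableTypeR R) A = mu A.
Proof.
move=> mA.
have ms : measurable_fun [set: R] ((fun x => x + c) : _ -> measurableTypeR R).
  exact: measurable_funD.
apply/esym/lebesgue_measure_unique => //= _ [[a b]] _ <-.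
rewrite /pushforward.
have -> : (fun x => x + c) @^-1` `]a, b] = `]a - c, b - c]%classic.
  by apply/seteqP; split => x /=; rewrite !in_itv /= ltrBlDr lerBrDr.
rewrite !lebesgue_measure_itv/= !lte_fin ltrD2r; case: ifP => // _.
by rewrite -!EFinD; congr (_%:E); ring.
Qed.

Lemma Rintegral_periodic_shift f (L a b : R) :
  measurable_fun [set: R] f ->
  mu.-integrable `[a, b] (EFin \o f) -> (forall x, f (x + L) = f x) ->
  \int[mu]_(x in `[a + L, b + L]) f x = \int[mu]_(x in `[a, b]) f x.
Proof.
move=> mf itf per; rewrite /Rintegral; congr fine.
pose sh (x : measurableTypeR R) : measurableTypeR R := (x : R) + L.
have ms : measurable_fun [set: measurableTypeR R] sh by exact: measurable_funD.
have pre : sh @^-1` `[a + L, b + L] = `[a, b]%classic.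
  by apply/seteqP; split => x /=; rewrite !in_itv /= !lerD2r.
have fsh : (EFin \o f) \o sh = EFin \o f by apply/funext => x /=; rewrite per.
transitivity (\int[pushforward mu sh]_(x in `[(a + L)%R, (b + L)%R])
    (f x)%:E)%E.
  apply: eq_measure_integral => //= A mA _.
  exact/esym/lebesgue_measure_shift.
apply: eq_trans.
  apply: (@integral_pushforward _ _ _ _ R _ ms _ _ (EFin \o f)) => //.
  - exact/measurable_EFinP.
  - by rewrite pre fsh.
by rewrite pre fsh.
Qed.

Section LocallyIntegrable.
Variable f : R -> R.
Hypothesis itf : forall a b, mu.-integrable `[a, b] (EFin \o f).

Lemma Rintegral_itv_cat a b c : a <= b -> b <= c ->
  \int[mu]_(x in `[a, c]) f x =
  \int[mu]_(x in `[a, b]) f x + \int[mu]_(x in `[b, c]) f x.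
Proof.
move=> ab bc; have := @Rintegral_itvB R f (BLeft a) (BRight c) b (itf a c).
rewrite !bnd_simp => /(_ ab bc) => H.
(* The closed intervals share the point [b]; it is removed from the right one, at no cost to the
   integral. *)
rewrite -(Rintegral_itv_obnd_cbnd (r := b)); last first.
  apply: integrableS (itf b c) => //.
  by move=> x /=; rewrite !in_itv /= => /andP[/ltW -> ->].
by rewrite -H addrC subrK.
Qed.

Lemma sum_Rintegral_itv (t : nat -> R) (n : nat) :
  (forall i, (i < n)%N -> t i <= t i.+1) ->
  \sum_(i < n) \int[mu]_(x in `[t i, t i.+1]) f x =
  \int[mu]_(x in `[t 0%N, t n]) f x.
Proof.
elim: n => [|n IH] tle.
  by rewrite big_ord0 set_itv1 Rintegral_set1.
rewrite big_ord_recr /= IH => [|i /ltnW/tle //].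
rewrite -Rintegral_itv_cat ?tle //.
have : forall m, (m <= n)%N -> t 0%N <= t m.
  elim=> // m IHm mn; apply: le_trans (IHm (ltnW mn)) _.
  by apply: tle; rewrite ltnS ltnW.
exact.
Qed.

(* Both sides complete to the integral over [a, b + L]; this needs no division
   of b - a by the period. *)
Lemma Rintegral_period (L a b : R) :
  measurable_fun [set: R] f -> 0 <= L -> (forall x, f (x + L) = f x) ->
  \int[mu]_(x in `[a, a + L]) f x = \int[mu]_(x in `[b, b + L]) f x.
Proof.
move=> mf L0 per; wlog ab : a b / a <= b.
  by move=> H; have [/H //|/ltW/H ->] := leP a b.
have := @Rintegral_itv_cat a b (b + L) ab.
rewrite (@Rintegral_itv_cat a (a + L) (b + L)) ?lerDl ?lerD2r // => /(_ L0).
(* The piece over [[a + L, b + L]] equals the one over [[a, b]] and cancels. *)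
by rewrite Rintegral_periodic_shift // [RHS]addrC => /addIr.
Qed.

End LocallyIntegrable.

Lemma horner_bounded (p : {poly R}) a b :
  exists M : R, forall x, a <= x <= b -> `|p.[x]| <= M.
Proof.
have [ab|ba] := leP a b; last first.
  by exists 0 => x /andP[/le_trans h /h]; rewrite leNgt ba.
have cp : {within `[a, b], continuous (fun x => `|p.[x]|)}.
  apply: continuous_subspaceT => x; apply: continuous_comp.
    exact: continuous_horner.
  exact: norm_continuous.
have [c _ Hc] := EVT_max ab cp.
by exists `|p.[c]| => x xab; apply: Hc; rewrite in_itv.
Qed.

Lemma integrable_mul_horner f (M : R) (p : {poly R}) a b :
  measurable_fun [set: R] f -> (forall x, `|f x| <= M) ->
  mu.-integrable `[a, b] (EFin \o (fun x => f x * p.[x])).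
Proof.
move=> mf fM; apply: measurable_bounded_integrable => //.
- by rewrite /= lebesgue_measure_itv /=; case: ifP => _ //; rewrite -EFinD ltry.
- apply: measurable_funM; first exact: measurable_funTS.
  exact: measurable_poly.
- have [K HK] := horner_bounded p a b.
  exists (M * K); split; first exact: num_real.
  move=> y My x /=; rewrite in_itv /= => xab.
  by apply: le_trans (ltW My); rewrite normrM ler_pM // HK.
Qed.

End Integrals.

(** * Regularity of the discrete functions *)

Section Scheme.
Variables (R : realType) (N k : nat) (S : eldg_data R N k).
Notation mu := (@lebesgue_measure R).
Notation L := (node S N - node S 0%N).

Lemma node_ltS i : (i < N)%N -> node S i < node S i.+1.
Proof. by move=> iN; exact: (node_lt S (Ordinal iN)). Qed.

Lemma node_le0 i : (i <= N)%N -> node S 0%N <= node S i.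
Proof.
elim: i => // i IH iN; apply: le_trans (IH (ltnW iN)) _.
by apply/ltW/node_ltS.
Qed.

Lemma period_gt0 : 0 < L.
Proof.
have e := prednK (N_gt0 S); rewrite subr_gt0.
apply: (@le_lt_trans _ _ (node S N.-1)).
  by apply: node_le0; rewrite leq_pred.
by rewrite -[X in _ < node S X]e; apply: node_ltS; rewrite e.
Qed.

(** Induction on the number of cells. Half-open intervals suit it: each step adds one mesh point,
    where the value is free, and one open cell, where [v] is a polynomial. *)
Lemma Vh_mesh (v : R -> R) : Vh S v -> forall i, (i <= N)%N ->
  measurable_fun `[node S 0%N, node S i[ v /\
  exists M : R, forall x, node S 0%N <= x < node S i -> `|v x| <= M.
Proof.
move=> [vp _]; elim=> [_|i IH iN].
  rewrite set_itvco0; split; first exact: measurable_fun_set0.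
  by exists 0 => x /andP[/le_lt_trans h /h]; rewrite ltxx.
have [mv [M HM]] := IH (ltnW iN).
have [p Hp] := vp (Ordinal iN); rewrite /= in Hp.
have le0 := node_le0 (ltnW iN); have ltS := node_ltS iN.
split.
  rewrite (@itv_bndbnd_setU _ _ _ (BLeft (node S i))) ?bnd_simp ?(ltW ltS) //.
  apply/measurable_funU => //; split => //.
  apply/measurable_fun_itv_obnd_cbndP.
  apply: (eq_measurable_fun (horner (p : {poly R}))).
    by move=> x /set_mem /=; rewrite in_itv /= => /Hp.
  exact: measurable_poly.
have [K HK] := horner_bounded (p : {poly R}) (node S i) (node S i.+1).
(* One term for each of the earlier cells, the mesh point and the new open cell. The absolute value
   of [M] is taken because for [i = 0] the earlier interval is empty and gives no sign. *)
exists (`|M| + (`|v (node S i)| + K)) => x /andP[x0 x1].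
have K0 : 0 <= K by apply: le_trans (HK (node S i) _) => //; rewrite lexx ltW.
have [xi|xi|->] := ltgtP x (node S i).
- apply: le_trans (HM _ _) _; first by rewrite x0.
  by rewrite (le_trans (ler_norm M)) // lerDl addr_ge0.
- rewrite Hp ?xi // addrA; apply: le_trans (HK x _) _; first by rewrite !ltW.
  by rewrite lerDr addr_ge0.
- by rewrite addrCA lerDl addr_ge0.
Qed.

(** Reduction modulo the period: [v] factors through the map [r] onto the base period, where
    [Vh_mesh] applies. *)
Lemma Vh_measurable_bounded (v : R -> R) : Vh S v ->
  measurable_fun [set: R] v /\ exists M : R, forall x, `|v x| <= M.
Proof.
move=> Vv; have [mv [M HM]] := Vh_mesh Vv (leqnn N).
have L0 := period_gt0; have per := periodicz (proj2 Vv).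
pose fl x : R := (Num.floor ((x - node S 0%N) / L))%:~R.
pose r x := x - fl x * L.
have rE x : v x = v (r x) by rewrite /r -mulNr -rmorphN per.
have rI x : node S 0%N <= r x < node S N.
  have := floor_itv ((x - node S 0%N) / L).
  rewrite -/(fl x) intrD -/(fl x) ler_pdivlMr // ltr_pdivrMr // mulrDl mul1r /r.
  by move=> /andP[? ?]; apply/andP; split; lra.
split; last by exists M => x; rewrite rE HM.
(* The floor part of [r] is monotone, hence measurable. *)
have mr : measurable_fun [set: R] r.
  apply: measurable_funB => //; apply: measurable_funM => //.
  apply: nondecreasing_measurable => // x y xy.
  rewrite /fl ler_int; apply: le_floor.
  by rewrite ler_pM2r ?invr_gt0 // lerD2r.
have -> : v = (v \_ `[node S 0%N, node S N[) \o r.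
  apply/funext => x /=; rewrite patchE rE ifT //.
  by apply/mem_set; rewrite /= in_itv rI.
apply: measurableT_comp => //.
exact/(measurable_restrictT v (measurable_itv _)).
Qed.

Lemma Vh_integrable (v : R -> R) (p : {poly R}) a b : Vh S v ->
  mu.-integrable `[a, b] (EFin \o (fun x => v x * p.[x])).
Proof.
by move=> /Vh_measurable_bounded[mv [M HM]]; exact: integrable_mul_horner HM.
Qed.

Lemma Vh_integrable1 (v : R -> R) a b : Vh S v ->
  mu.-integrable `[a, b] (EFin \o v).
Proof.
move=> /(Vh_integrable 1 a b); congr (mu.-integrable _ (_ \o _)).
by apply/funext => x; rewrite hornerC mulr1.
Qed.

(** The weights [e] are the coordinates of the constant 1 in the basis; they turn degrees of freedom
    into cell masses. *)
Lemma Psi_span1 (j : 'I_N) :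
  exists e : 'I_k.+1 -> R, \sum_m e m *: Psi S j m = 1.
Proof.
pose one : {poly_k.+1 R} := npolyp k.+1 1.
exists (fun m => coord (Defs.basis S j) m one).
have /(congr1 val) := coord_basis (basisP S j) (memvf one).
rewrite /= npolypK ?size_poly1 // => ->.
by rewrite raddf_sum /=; apply: eq_bigr => m _; rewrite /Psi (tnth_nth 0).
Qed.

Lemma horner_Psi_sum (j : 'I_N) (e : 'I_k.+1 -> R) x :
  \sum_m e m *: Psi S j m = 1 -> \sum_m e m * (Psi S j m).[x] = 1.
Proof.
move=> e1; have := hornerC 1 x; rewrite -[X in X.[x]]e1 horner_sum.
by apply: etrans; apply: eq_bigr => m _; rewrite hornerZ.
Qed.

(** The weighted test functions sum to 1, so both fluxes get weight 1, and the derivatives sum to 0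
    at every Gauss node, which removes the volume term. *)
Lemma rhs_sum (u : dsol R N k) t (j : 'I_N) (e : 'I_k.+1 -> R) :
  \sum_m e m *: Psi S j m = 1 ->
  \sum_m e m * rhs S u t j m = - (flux S u t j - flux S u t (ord_pred j)).
Proof.
move=> e1.
have P' x : \sum_m e m * (Psi S j m)^`().[x] = 0.
  have := congr1 (fun p => (deriv p).[x]) e1.
  rewrite derivC horner0 raddf_sum horner_sum.
  by apply: etrans; apply: eq_bigr => m _; rewrite /= derivZ hornerZ.
rewrite /rhs /gauss.
under eq_bigr do rewrite !mulrDr !(mulrCA (e _)).
rewrite !big_split /= -!mulr_sumr !horner_Psi_sum //.
under eq_bigr do rewrite mulr_sumr.
rewrite exchange_big /= [X in _ + X]big1 => [|i _]; first by ring.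
under eq_bigr do rewrite 2!(mulrCA (e _)).
by rewrite -!mulr_sumr P' !mulr0.
Qed.

(** * Cell masses through one step *)

Section Step.
Variables (rk : ssp_rk R) (un un1 : R -> R) (U : nat -> 'I_N -> 'I_k.+1 -> R).
Variable w : nat -> dsol R N k.
Hypothesis step : eldg_step S rk un U w un1.
Variables (j : 'I_N) (e : 'I_k.+1 -> R).
Hypothesis e1 : \sum_m e m *: Psi S j m = 1.

Lemma mass_init :
  \sum_m e m * U 0%N j m = \int[mu]_(x in upstream_cell S j) un x.
Proof.
under eq_bigr do rewrite (step_init step).
rewrite sum_RintegralZ /upstream_cell //.
  apply: eq_Rintegral => x _.
  pose y := node S j + (x - tnode S j (tn S)) / jac S j (tn S).
  rewrite -[RHS]mulr1 -(horner_Psi_sum y e1) mulr_sumr.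
  by apply: eq_bigr => m _; rewrite mulrCA.
move=> m.
(* The affine pullback to the reference cell, which makes [psi j m] at time [tn] the polynomial
   [Psi j m] composed with [q], hence integrable against [un]. *)
pose q : {poly R} := (node S j - tnode S j (tn S) / jac S j (tn S))%:P
   + (jac S j (tn S))^-1 *: 'X.
have := @Vh_integrable un (Psi S j m \Po q) (tnode S j (tn S))
  (tnode S j.+1 (tn S)) (step_un step).
congr (mu.-integrable _ (_ \o _)).
apply/funext => x; rewrite /psi horner_comp; congr (_ * _.[_]).
by rewrite /q !hornerE; ring.
Qed.

Lemma mass_final :
  \sum_m e m * U (rk_s rk) j m = \int[mu]_(x in `[node S j, node S j.+1]) un1 x.
Proof.
under eq_bigr do rewrite -(step_final step).
rewrite sum_RintegralZ // => [|m]; last exact: Vh_integrable (step_un1 step).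
apply: eq_Rintegral => x _.
rewrite -[RHS]mulr1 -(horner_Psi_sum x e1) mulr_sumr.
by apply: eq_bigr => m _; rewrite mulrCA.
Qed.

(** This is the recursion required by [rk_unroll], with minus the flux difference as [F]. *)
Lemma mass_stage i : (0 < i <= rk_s rk)%N ->
  \sum_m e m * U i j m = \sum_(l < i) (rk_alpha rk i l * (\sum_m e m * U l j m)
    + rk_beta rk i l * dt S * - (flux S (w l) (stage_time S rk l) j
        - flux S (w l) (stage_time S rk l) (ord_pred j))).
Proof.
move=> ile; under eq_bigr do rewrite (step_stage step ile) mulr_sumr.
rewrite exchange_big /=; apply: eq_bigr => l _.
rewrite -(rhs_sum _ _ e1) !mulr_sumr -big_split /=.
by apply: eq_bigr => m _; ring.
Qed.

End Step.

(** * Upstream cells over one period *)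

(** The upstream cell has the length of the mesh cell times the Jacobian, which is positive. *)
Lemma tnode_le (j : 'I_N) :
  no_crossing S -> tnode S j (tn S) <= tnode S j.+1 (tn S).
Proof.
move=> /(_ j (tn S)); rewrite lexx lerDl ltW ?dt_gt0 // => /(_ isT) J.
have nlt := node_lt S j.
have n0 : node S j.+1 - node S j != 0 by rewrite subr_eq0 gt_eqF.
rewrite -subr_ge0.
suff -> : tnode S j.+1 (tn S) - tnode S j (tn S)
    = jac S j (tn S) * (node S j.+1 - node S j).
  by rewrite mulr_ge0 ?ltW // subr_gt0.
by rewrite /tnode /jac; field.
Qed.

(** Periodicity of the velocity at time [tn1] gives both end nodes the same [nu], so they are
    displaced equally. *)
Lemma tnode_period t : tnode S N t = tnode S 0%N t + L.
Proof.
have -> : tnode S N t = node S N - nu S N * (tn1 S - t) by [].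
have -> : nu S N = nu S 0%N.
  rewrite /nu -[RHS](vel_periodic (e := S)) ?lerDl ?lexx ?ltW ?dt_gt0 //.
  by rewrite addrC subrK.
by rewrite /tnode; ring.
Qed.

Lemma sum_upstream (v : R -> R) : no_crossing S -> Vh S v ->
  \sum_(j < N) \int[mu]_(x in upstream_cell S j) v x =
  \sum_(j < N) \int[mu]_(x in `[node S j, node S j.+1]) v x.
Proof.
move=> nc Vv; have itv a b := Vh_integrable1 a b Vv.
have [mv _] := Vh_measurable_bounded Vv.
rewrite (sum_Rintegral_itv itv (t := fun i => tnode S i (tn S))); last first.
  by move=> i iN; exact: (tnode_le (Ordinal iN) nc).
rewrite (sum_Rintegral_itv itv (t := node S)); last first.
  by move=> i iN; exact/ltW/node_ltS.
(* The upstream cells fill a period starting at [tnode 0]; it is moved to start at [node 0]. *)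
rewrite tnode_period (Rintegral_period itv _ (node S 0%N) mv (ltW period_gt0)).
  by rewrite addrC subrK.
exact: (proj2 Vv).
Qed.

End Scheme.

Unset Implicit Arguments.

Theorem theorem2p1 (R : realType) (rk : ssp_rk R) :
  locally_mass_conservative rk /\
  (forall (N k : nat) (S : eldg_data R N k) (un un1 : R -> R)
     (U : nat -> 'I_N -> 'I_k.+1 -> R) (w : nat -> dsol R N k),
   no_crossing S -> eldg_step S rk un U w un1 ->
   \sum_(j < N) \int[lebesgue_measure]_(x in `[node S j, node S j.+1]) un1 x =
   \sum_(j < N) \int[lebesgue_measure]_(x in `[node S j, node S j.+1]) un x).
Proof.
have cons : locally_mass_conservative rk.
  have [c Hc] := rk_unroll (rk_beta rk) (@rk_alpha_sum R rk).
  (* The last row of unrolled coefficients, fixed before the mesh and the data. *)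
  exists (c (rk_s rk)) => N k S un un1 U w _ step j.
  have [e e1] := Psi_span1 S j.
  rewrite -(mass_final step e1) -(mass_init step e1).
  pose F l := - (flux S (w l) (stage_time S rk l) j
                 - flux S (w l) (stage_time S rk l) (ord_pred j)).
  rewrite (Hc (fun i => \sum_m e m * U i j m) F (dt S)) //.
    rewrite -mulrN -sumrN; congr (_ + _ * _).
    by apply: eq_bigr => l _; rewrite mulrN.
  by move=> i ile; rewrite (mass_stage step e1 ile).
split => // N k S un un1 U w nc step; have [c Hc] := cons.
under eq_bigr do rewrite (Hc _ _ _ _ _ _ _ nc step).
rewrite sumrB (sum_upstream nc (step_un step)) -mulr_sumr exchange_big /=.
(* At each stage, reindexing by the cyclic predecessor turns the sum of right fluxes into the sum of
   left fluxes. *)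
rewrite [X in _ * X]big1 ?mulr0 ?subr0 // => l _.
rewrite -mulr_sumr sumrB [X in X - _](reindex_inj (can_inj (@ord_predK N))).
by rewrite subrr mulr0.
Qed.
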